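(* Let $m\ge 1$. For the Cartesian product $P_2\square F_m$ of the path $P_2$ of order $2$ and the fan graph $F_m$ of order $m+1$, the harmonic centralization is $$C_{\mathcal H}(P_2\square F_m)=\frac{4(m-1)(m-2)}{3m(2m+1)}.$$
   Context: All graphs are simple, undirected and finite. For a graph $G$ of order $n\ge 2$ (number of vertices) and a vertex $u$, the harmonic centrality of $u$ is $\mathcal{H}_G(u)=\frac{\mathcal{R}_G(u)}{n-1}$, where $\mathcal{R}_G(u)=\sum_{x\in V(G),\,x\ne u}\frac{1}{d(u,x)}$, $d$ is the shortest-path distance in $G$, and $\frac{1}{d(u,x)}=0$ if there is no path from $u$ to $x$. For a graph $G$ of order $n\ge 3$, the harmonic centralization is $$C_{\mathcal H}(G)=\frac{\sum_{x\in V(G)}\big(\mathcal{H}_{G,\max}-\mathcal{H}_G(x)\big)}{\frac{n-2}{2}},\qquad \mathcal{H}_{G,\max}=\max_{x\in V(G)}\mathcal{H}_G(x).$$ The fan $F_m$ has vertices $v_0,v_1,\dots,v_m$, where $v_1,\dots,v_m$ form a path with edges $v_kv_{k+1}$ ($1\le k<m$) and the hub $v_0$ is adjacent to each of $v_1,\dots,v_m$. The Cartesian product $G\square H$ has vertex set $V(G)\times V(H)$, with $(u,v)$ and $(u',v')$ adjacent iff either $u=u'$ and $v,v'$ are adjacent in $H$, or $v=v'$ and $u,u'$ are adjacent in $G$. *)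

(* Defs.v *)
From HB Require Import structures.
From mathcomp Require Import all_boot all_order all_algebra.
Set Implicit Arguments.
Unset Strict Implicit.
Unset Printing Implicit Defensive.
Import Order.TTheory GRing.Theory Num.Theory.
Local Open Scope ring_scope.

Record sgraph := SGraph {
  vertex :> finType;
  adj : rel vertex;
  adj_sym : symmetric adj;
  adj_irrefl : irreflexive adj
}.

Definition walk (G : sgraph) (k : nat) (x y : G) : bool :=
  [exists p : k.-tuple G, path (@adj G) x p && (last x p == y)].

Lemma connect_walk (G : sgraph) (x y : G) :
  connect (@adj G) x y -> exists k, walk k x y.
Proof.
case/connectP=> p pP ->; exists (size p); apply/existsP.
by exists (in_tuple p); rewrite pP eqxx.
Qed.

Definition dist (G : sgraph) (x y : G) : option nat :=
  if boolP (connect (@adj G) x y) is AltTrue c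
  then Some (ex_minn (connect_walk c)) else None.

Definition inv_dist (G : sgraph) (x y : G) : rat :=
  if dist x y is Some d then d%:R^-1 else 0.

Definition harmonic_sum (G : sgraph) (u : G) : rat :=
  \sum_(x : G | x != u) inv_dist u x.

Definition harmonic_centrality (G : sgraph) (u : G) : rat :=
  harmonic_sum u / (#|G|%:R - 1).

(* Harmonic centralities are nonnegative for #|G| >= 2, so starting the
   iterated maximum at 0 does not change its value. *)
Definition max_harmonic_centrality (G : sgraph) : rat :=
  \big[Num.max/0]_(x : G) harmonic_centrality x.

Definition harmonic_centralization (G : sgraph) : rat :=
  (\sum_(x : G) (max_harmonic_centrality G - harmonic_centrality x))
  / ((#|G|%:R - 2) / 2).

Section PathGraph.
Variable n : nat.

Definition path_adj : rel 'I_n :=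
  fun i j => (i.+1 == j :> nat) || (j.+1 == i :> nat).

Lemma path_adj_sym : symmetric path_adj.
Proof. by move=> i j; rewrite /path_adj orbC. Qed.

Lemma path_adj_irrefl : irreflexive path_adj.
Proof. by move=> i; rewrite /path_adj orbb gtn_eqF. Qed.

Definition path_graph : sgraph := SGraph path_adj_sym path_adj_irrefl.
End PathGraph.

Section FanGraph.
Variable m : nat.

(* The ordinal k stands for the vertex v_k; the hub is 0. *)
Definition fan_adj : rel 'I_m.+1 := fun i j =>
  [|| (i == 0%N :> nat) && (0 < j)%N,
      (j == 0%N :> nat) && (0 < i)%N
    | [&& (0 < i)%N, (0 < j)%N & (i.+1 == j :> nat) || (j.+1 == i :> nat)]].

Lemma fan_adj_sym : symmetric fan_adj.
Proof.
move=> i j; rewrite /fan_adj orbCA; congr [|| _, _ | _].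
by rewrite andbCA [X in [&& _, _ & X]]orbC.
Qed.

Lemma fan_adj_irrefl : irreflexive fan_adj.
Proof.
by case=> [[|k] lt_k]; rewrite /fan_adj //= orbb gtn_eqF.
Qed.

Definition fan_graph : sgraph := SGraph fan_adj_sym fan_adj_irrefl.
End FanGraph.

Section CartesianProduct.
Variables G H : sgraph.

Definition cart_adj : rel (G * H)%type := fun x y =>
  ((x.1 == y.1) && adj x.2 y.2) || ((x.2 == y.2) && adj x.1 y.1).

Lemma cart_adj_sym : symmetric cart_adj.
Proof.
move=> x y; rewrite /cart_adj (eq_sym x.1) (eq_sym x.2).
by rewrite (adj_sym x.1) (adj_sym x.2).
Qed.

Lemma cart_adj_irrefl : irreflexive cart_adj.
Proof. by move=> x; rewrite /cart_adj !adj_irrefl !andbF. Qed.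

Definition cart_prod : sgraph := SGraph cart_adj_sym cart_adj_irrefl.
End CartesianProduct.

(* Main.v *)
(* If G has a universal vertex then dist is 0, 1 or 2 on G, and a vertex (a, i)
   of P_2 □ G sees each (b, j) at distance [a != b] + dist i j.  The two copies
   of j contribute together 1, 3/2 or 5/6 according as j = i, j ~ i or neither,
   so the harmonic sum at (a, i) is the affine function
   5/6 |G| + 1/6 + 2/3 deg i of the degree.  It is maximal at the universal
   vertex, and the centralization depends only on the degree sum of the fan,
   which is 2 (2m - 1). *)
Require Import Defs.
From HB Require Import structures.
From mathcomp Require Import all_boot all_order all_algebra.
From mathcomp Require Import ring lra zify.
Set Implicit Arguments.
Unset Strict Implicit.
Unset Printing Implicit Defensive.
Import Order.TTheory GRing.Theory Num.Theory.
Local Open Scope ring_scope.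

Lemma walkP (G : sgraph) (k : nat) (x y : G) :
  reflect (exists p, [/\ size p = k, path (@adj G) x p & last x p = y])
          (walk k x y).
Proof.
apply: (iffP existsP) => [[p /andP[pP /eqP <-]]|[p [<- pP <-]]].
  by exists p; rewrite size_tuple.
by exists (in_tuple p); rewrite pP eqxx.
Qed.

(* These three conditions characterize the distance from x. *)
Definition dist_profile (G : sgraph) (x : G) (f : G -> nat) : Prop :=
  [/\ f x = 0%N,
      forall y z, adj y z -> (f z <= (f y).+1)%N
    & forall y, y != x -> exists2 z, adj z y & f y = (f z).+1].

(** The third condition gives each vertex other than [x] a neighbour with value one less; stepping
    down repeatedly ends at [x] after [f y] steps. *)
Lemma dist_profile_walk (G : sgraph) (x : G) f :
  dist_profile x f -> forall y, walk (f y) x y.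
Proof.
move=> [f0 _ fS] y; have [n] := ubnP (f y).
elim: n y => // n IHn y; rewrite ltnS => le_fy; apply/walkP.
have [->|/fS[z zy fy]] := eqVneq y x; first by exists [::]; rewrite f0.
have /walkP[p [sp pP lp]] : walk (f z) x z by apply: IHn; rewrite -fy.
exists (rcons p y).
by rewrite size_rcons sp rcons_path pP lp last_rcons.
Qed.

(** Along each edge [f] grows by at most one, and it starts at 0. *)
Lemma dist_profile_le (G : sgraph) (x : G) f :
  dist_profile x f -> forall k y, walk k x y -> (f y <= k)%N.
Proof.
move=> [f0 fle _] k y /walkP[p [<- pP <-]]; rewrite -[size p]add0n -f0.
elim: p x {f0} pP => [|z p IHp] x /=; first by rewrite addn0.
case/andP=> /fle le_z /IHp le_l; apply: leq_trans le_l _.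
by rewrite addnS -addSn leq_add2r.
Qed.

Lemma dist_profileE (G : sgraph) (x : G) f :
  dist_profile x f -> forall y, dist x y = Some (f y).
Proof.
move=> fP y; have wf := dist_profile_walk fP y.
rewrite /dist; destruct (boolP _) as [c|c]; last case/negP: c.
  case: ex_minnP => k /(dist_profile_le fP) le_fk le_k.
  by congr Some; apply/eqP; rewrite eqn_leq le_fk le_k.
by have /walkP[p [_ pP <-]] := wf; apply/connectP; exists p.
Qed.

(* At y = x the summand is 0^-1 = 0, so that term need not be excluded. *)
Lemma harmonic_sum_profile (G : sgraph) (x : G) f :
  dist_profile x f -> harmonic_sum x = \sum_y (f y)%:R^-1.
Proof.
move=> fP; rewrite [RHS](bigD1 x) //=.
have [-> _ _] := fP; rewrite invr0 add0r.
by apply: eq_bigr => y _; rewrite /inv_dist (dist_profileE fP).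
Qed.

(** Each edge of the product moves one coordinate only, so distances add. A predecessor is found by
    moving the first coordinate towards [x], and the second towards [u] once the first equals
    [x]. *)
Lemma dist_profile_cart (G H : sgraph) (x : G) (u : H) f g :
  dist_profile x f -> dist_profile u g ->
  dist_profile ((x, u) : cart_prod G H) (fun y => f y.1 + g y.2)%N.
Proof.
move=> [f0 fle fS] [g0 gle gS]; split=> [|[y v] [z w]|[y v]] /=.
- by rewrite f0 g0.
- case/orP=> /= /andP[/eqP-> a]; first by rewrite -addnS leq_add2l gle.
  by rewrite -addSn leq_add2r fle.
- have [->|/fS[z zy fy] _] := eqVneq y x; last first.
    by exists (z, v); rewrite /= ?fy // /cart_adj /= zy eqxx orbT.
  rewrite xpair_eqE eqxx /= => /gS[w wv gv].
  by exists (x, w); rewrite /= ?gv ?addnS // /cart_adj /= wv eqxx.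
Qed.

Lemma dist_profile_path2 (a : path_graph 2) :
  dist_profile a (fun b => (a != b) : nat).
Proof.
split=> [|b c _|b neq_ba]; first by rewrite eqxx.
  by case: (a != c).
exists a; last by rewrite eqxx eq_sym neq_ba.
by case: a b neq_ba => [[|[|?]] ?] [[|[|?]] ?].
Qed.

Definition universal (G : sgraph) (h : G) : Prop :=
  forall y, y != h -> adj h y.

Definition dist2 (G : sgraph) (x y : G) : nat :=
  if x == y then 0 else if adj x y then 1 else 2.

Lemma dist_profile_universal (G : sgraph) (h x : G) :
  universal h -> dist_profile x (dist2 x).
Proof.
move=> hU; rewrite /dist2; split=> [|y z yz|y neq_yx]; first by rewrite eqxx.
  have [xy|_] := eqVneq x y; first by rewrite xy yz; case: ifP.
  by do 3?case: ifP.
have neq_xy : (x == y) = false by rewrite eq_sym (negbTE neq_yx).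
rewrite neq_xy; case: ifP => [xy|nxy]; first by exists x => //; rewrite eqxx.
(* Here [x] and [y] are distinct and not adjacent, so neither is [h], and [h] is the midpoint of a
   walk of length 2. *)
have neq_yh : y != h.
  by apply/eqP=> eq_yh; rewrite eq_yh adj_sym hU // -eq_yh neq_xy in nxy.
exists h; first exact: hU.
have neq_xh : x != h by apply/eqP=> eq_xh; rewrite eq_xh hU in nxy.
by rewrite (negbTE neq_xh) adj_sym hU.
Qed.

Definition degree (G : sgraph) (x : G) : nat := (\sum_y adj x y)%N.

Lemma degree_universal (G : sgraph) (h : G) :
  universal h -> degree h = #|G|.-1.
Proof.
move=> hU; rewrite /degree (bigD1 h) //= adj_irrefl add0n.
rewrite (eq_bigr (fun=> 1%N)) => [|y /hU-> //].
by rewrite sum1_card cardC1.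
Qed.

Lemma degree_le (G : sgraph) (x : G) : (degree x <= #|G|.-1)%N.
Proof.
rewrite /degree (bigD1 x) //= adj_irrefl add0n -(cardC1 x) -sum1_card.
by apply: leq_sum => y _; case: adj.
Qed.

Lemma harmonic_sum_prism (G : sgraph) (h : G) :
  universal h -> forall u : cart_prod (path_graph 2) G,
  harmonic_sum u = 5 / 6 * #|G|%:R + 1 / 6 + 2 / 3 * (degree u.2)%:R.
Proof.
move=> hU [a x] /=.
rewrite (harmonic_sum_profile (dist_profile_cart
  (dist_profile_path2 a) (dist_profile_universal x hU))).
rewrite -(pair_bigA _ (fun b y => ((a != b) + dist2 x y)%N%:R^-1)) /=.
rewrite exchange_big /=.
(* The values 1, 3/2 and 5/6 are written with indicators: 1 = 5/6 + 1/6 and 3/2 = 5/6 + 2/3. *)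
transitivity (\sum_y (5 / 6 + (x == y)%:R / 6 + 2 / 3 * (adj x y)%:R : rat)).
  apply: eq_bigr => y _.
  (* Whichever copy [a] is, the two copies of [y] lie at distances d and d + 1. For [y = x] the term
     with d = 0 is [0^-1 = 0]. *)
  have -> : \sum_(b < 2) ((a != b) + dist2 x y)%N%:R^-1 =
            (dist2 x y)%:R^-1 + (dist2 x y).+1%:R^-1 :> rat.
    rewrite !big_ord_recl big_ord0 addr0.
    case: a => [[|[|?]] ?] //=.
    by rewrite add0n add1n addrC.
  rewrite /dist2; have [<-|_] := eqVneq x y; first by rewrite adj_irrefl.
  by case: adj.
rewrite !big_split /= sumr_const -[_ *+ #|_|]mulr_natr -mulr_sumr -mulr_suml.
rewrite -!natr_sum.
congr (_ + _ / _ + _); rewrite (bigD1 x) //= eqxx big1 // => y.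
by rewrite eq_sym => /negbTE->.
Qed.

Lemma max_harmonic_centralityE (G : sgraph) (u : G) :
  0 <= harmonic_centrality u ->
  (forall x : G, harmonic_centrality x <= harmonic_centrality u) ->
  max_harmonic_centrality G = harmonic_centrality u.
Proof.
move=> u0 uM; apply/le_anti/andP; split; last exact: le_bigmax.
by apply: bigmax_le.
Qed.

Lemma universal_fan (m : nat) : universal (ord0 : fan_graph m).
Proof. by case=> [[|k] ltk]. Qed.

(** This counts the edges of a path on [n.+1] vertices: every vertex but the first has exactly one
    predecessor. *)
Lemma sum_succ_eq (n : nat) :
  (\sum_(i < n.+1) \sum_(j < n.+1) (i.+1 == j))%N = n.
Proof.
rewrite exchange_big big_ord_recl /= big1_eq add0n.
rewrite -[RHS]card_ord -sum1_card; apply: eq_bigr => j _.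
rewrite (bigD1 (widen_ord (leqnSn n) j)) //= eqxx big1 // => i.
by rewrite -val_eqE /= /bump add1n eqSS => /negbTE->.
Qed.

Lemma degree_sum_fan (n : nat) :
  (\sum_i degree (i : fan_graph n.+1))%N = (4 * n + 2)%N.
Proof.
rewrite big_ord_recl degree_universal; last exact: universal_fan.
rewrite card_ord /=.
(* The hub has degree [n.+1]; the path vertices contribute their successors, their predecessors and
   one spoke each. *)
transitivity (n.+1 + (\sum_(i < n.+1) \sum_(j < n.+1) (i.+1 == j)
  + (\sum_(i < n.+1) \sum_(j < n.+1) (j.+1 == i) + n.+1)))%N.
  rewrite -[X in (_ + (_ + (_ + X)))%N](card_ord n.+1) -sum1_card.
  rewrite -!big_split /=; congr addn; apply: eq_bigr => i _.
  rewrite /degree big_ord_recl addnA addnC /= -big_split /=.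
  congr addn; apply: eq_bigr => j _.
  rewrite /= /fan_adj /= /bump !add1n !eqSS.
  (* No vertex is both successor and predecessor of another, so the disjunction is a sum. *)
  by case: eqP => [<-|_] //=; rewrite gtn_eqF.
by rewrite [X in (_ + (_ + (X + _)))%N]exchange_big /= !sum_succ_eq; lia.
Qed.

Theorem theorem3p6 (m : nat) (hm : (1 <= m)%N) :
  harmonic_centralization (cart_prod (path_graph 2) (fan_graph m)) =
  (4 * (m%:R - 1) * (m%:R - 2)) / (3 * m%:R * (2 * m%:R + 1)) :> rat.
Proof.
have hU := @universal_fan m.
set P := cart_prod _ _.
pose hub : P := (ord0, ord0).
have cP : #|P| = (2 * m.+1)%N by rewrite card_prod !card_ord.
have cP1 : #|P|%:R - 1 = 2 * m%:R + 1 :> rat.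
  by rewrite cP natrM -natr1; ring.
have m0 : 0 < m%:R :> rat by rewrite ltr0n.
have cP0 : 0 < #|P|%:R - 1 :> rat by rewrite cP1; lra.
have cF : #|fan_graph m| = m.+1 by rewrite card_ord.
have HE (u : P) : harmonic_centrality u =
    (5 / 6 * m.+1%:R + 1 / 6 + 2 / 3 * (degree u.2)%:R) / (2 * m%:R + 1).
  by rewrite /harmonic_centrality (harmonic_sum_prism hU) cP1 cF.
have dh : degree (ord0 : fan_graph m) = m by rewrite degree_universal // cF.
rewrite /harmonic_centralization (@max_harmonic_centralityE _ hub); first last.
- move=> x; rewrite !HE -cP1 ler_pM2r ?invr_gt0 // lerD2l ler_pM2l //.
  by rewrite ler_nat dh; have := degree_le x.2; rewrite cF.
- rewrite HE -cP1; apply: divr_ge0 (ltW cP0).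
  by rewrite !addr_ge0 // mulr_ge0 // ler0n.
(* The constant terms cancel, leaving multiples of the degree deficits relative to the hub, whose
   degree is [m]. *)
have -> : \sum_(x : P) (harmonic_centrality hub - harmonic_centrality x) =
    \sum_(a < 2) \sum_(i : fan_graph m)
      (2 / 3 / (2 * m%:R + 1) * (m%:R - (degree i)%:R)).
  rewrite pair_bigA /=; apply: eq_bigr => x _; rewrite !HE dh -mulrBl.
  by ring.
rewrite sumr_const card_ord -mulr_sumr big_split /= sumr_const cF sumrN.
rewrite -natr_sum.
(* With [m = n.+1] the degree sum is [4 * n + 2], and all denominators are positive. *)
case: m hm {hU P hub cP cP1 cP0 cF HE dh} m0 => // n _ _.
rewrite degree_sum_fan card_prod !card_ord.
rewrite -[_ *+ n.+2]mulr_natr natrD !natrM -[n.+2%:R]natr1 -[n.+1%:R]natr1.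
have n0 : 0 <= n%:R :> rat by rewrite ler0n.
by field; apply/and3P; split; lra.
Qed.
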